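(* Consider a two-layer multilayer network game with intra-layer matrices $G^{(1)},G^{(2)}\in\mathbb{R}^{N\times N}$ (zero diagonals) and inter-layer matrices $G^{(12)},G^{(21)}\in\mathbb{R}^{N\times N}$. Suppose both layers are games of strategic complements, i.e., $g^{(l)}_{ij}\leq 0$ for all $i$, $j\neq i$, $l\in\{1,2\}$, and that $I+G^{(1)}$ and $I+G^{(2)}$ are P-matrices. If $$\|(I+G^{(1)})^{-1}\|_2\,\|G^{(12)}\|_2<1\quad\text{and}\quad\|(I+G^{(2)})^{-1}\|_2\,\|G^{(21)}\|_2<1,$$ where $\|A\|_2=\sup_{x\neq0}\|Ax\|_2/\|x\|_2$ is the spectral matrix norm, then the multilayer network game has a unique Nash equilibrium (for all admissible benefit functions and unit costs).
   Context: A square real matrix is a P-matrix if all its principal minors are strictly positive. Multilayer network game: there are $N$ agents; agent $i$ chooses an effort $x_i^{(l)}\in\mathbb{R}_{\geq0}$ in each layer $l\in\{1,2\}$. Agent $i$'s utility from layer $l$ (with $k$ the other layer) is $$u_i^{(l)}=b_i^{(l)}\Bigl(x_i^{(l)}+\sum_{j=1}^N g^{(l)}_{ij}x_j^{(l)}+\sum_{j=1}^N g^{(lk)}_{ij}x_j^{(k)}\Bigr)-c_i^{(l)}x_i^{(l)},$$ and its total utility is $\kappa u_i^{(1)}+(1-\kappa)u_i^{(2)}$. Each benefit function $b_i^{(l)}:\mathbb{R}\to\mathbb{R}$ is twice differentiable, strictly increasing and strictly concave, $c_i^{(l)}>0$, and it is assumed that there is a (necessarily unique) $q_i^{(l)}\in\mathbb{R}$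 with $(b_i^{(l)})'(q_i^{(l)})=c_i^{(l)}$ (this is what ''admissible'' means). Nash equilibria of the game are the solutions of the linear best-reply system: vectors $\mathbf{x}^*=(\mathbf{x}^{*(1)},\mathbf{x}^{*(2)})\in\mathbb{R}^{2N}_{\geq 0}$ with $\mathbf{x}^*=\max\{\mathbf{0},\,\mathbf{q}-\mathbf{G}\mathbf{x}^*\}$ componentwise, where $\mathbf{q}=(\mathbf{q}^{(1)},\mathbf{q}^{(2)})$ and $\mathbf{G}=\begin{pmatrix} G^{(1)} & G^{(12)} \\ G^{(21)} & G^{(2)} \end{pmatrix}$. *)

(* Defs.v *)
From mathcomp Require Import all_boot all_order all_algebra.
From mathcomp Require Import all_classical all_reals all_analysis.
From mathcomp Require Import ring lra.

Set Implicit Arguments.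
Unset Strict Implicit.
Unset Printing Implicit Defensive.

Import Order.TTheory GRing.Theory Num.Theory.
Import numFieldNormedType.Exports.

Local Open Scope classical_set_scope.
Local Open Scope ring_scope.

(* [S = set0] contributes the empty determinant, which is 1. *)
Definition P_matrix (R : realType) (n : nat) (A : 'M[R]_n) : Prop :=
  forall S : {set 'I_n},
    0 < \det (mxsub (@enum_val _ (mem S)) (@enum_val _ (mem S)) A).

Definition euclidean_norm (R : realType) (n : nat) (x : 'cV[R]_n) : R :=
  Num.sqrt (\sum_i x i 0 ^+ 2).

(* The set of quotients is bounded; it is empty only if [n = 0], where
   [sup set0 = 0]. *)
Definition spectral_norm (R : realType) (m n : nat) (A : 'M[R]_(m, n)) : R :=
  sup [set euclidean_norm (A *m x) / euclidean_norm x
      | x in [set x : 'cV[R]_n | x != 0]].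

Definition strictly_concave (R : realType) (b : R -> R) : Prop :=
  forall x y t : R, x != y -> 0 < t < 1 ->
    t * b x + (1 - t) * b y < b (t * x + (1 - t) * y).

Definition admissible_benefit (R : realType) (b : R -> R) (c : R) : Prop :=
  [/\ forall t, derivable b t 1,
      forall t, derivable b^`()%classic t 1,
      {homo b : s t / s < t},
      strictly_concave b &
      0 < c /\ exists q, b^`()%classic q = c].

(* [inter12] is the influence of the layer-2 efforts on layer 1, and [inter21]
   that of the layer-1 efforts on layer 2. *)
Record multilayer_game (R : realType) (N : nat) := MultilayerGame {
  weight : R;
  intra1 : 'M[R]_N;
  intra2 : 'M[R]_N;
  inter12 : 'M[R]_N;
  inter21 : 'M[R]_N;
  benefit1 : 'I_N -> R -> R;
  benefit2 : 'I_N -> R -> R;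
  cost1 : 'I_N -> R;
  cost2 : 'I_N -> R }.

Section Game.
Variables (R : realType) (N : nat).
Implicit Types (Gam : multilayer_game R N) (x : 'cV[R]_(N + N)).

Definition admissible Gam : Prop :=
  forall i, admissible_benefit (benefit1 Gam i) (cost1 Gam i) /\
            admissible_benefit (benefit2 Gam i) (cost2 Gam i).

Definition layer_utility (b : 'I_N -> R -> R) (c : 'I_N -> R) (Gl Glk : 'M[R]_N)
    (xl xk : 'cV[R]_N) (i : 'I_N) : R :=
  b i (xl i 0 + \sum_j Gl i j * xl j 0 + \sum_j Glk i j * xk j 0)
  - c i * xl i 0.

(* The first block of [x] holds the efforts in layer 1, the second one those in
   layer 2. *)
Definition utility Gam x (i : 'I_N) : R :=
  weight Gam * layer_utility (benefit1 Gam) (cost1 Gam)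
                 (intra1 Gam) (inter12 Gam) (usubmx x) (dsubmx x) i +
  (1 - weight Gam) * layer_utility (benefit2 Gam) (cost2 Gam)
                 (intra2 Gam) (inter21 Gam) (dsubmx x) (usubmx x) i.

(* The solution of [b'(q) = c]; it exists and is unique for admissible data. *)
Definition target (b : R -> R) (c : R) : R := xget 0 [set q | b^`()%classic q = c].

Definition targets Gam : 'cV[R]_(N + N) :=
  col_mx (\col_i target (benefit1 Gam i) (cost1 Gam i))
         (\col_i target (benefit2 Gam i) (cost2 Gam i)).

Definition network_matrix Gam : 'M[R]_(N + N) :=
  block_mx (intra1 Gam) (inter12 Gam) (inter21 Gam) (intra2 Gam).

(* Nash equilibria are the solutions of the layerwise best-reply system. If no
   agent's effort in one layer enters its own benefit in the other layer, this
   is the optimality of every agent's efforts for its total utility, see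
   [nash_equilibriumP]. *)
Definition nash_equilibrium Gam x : Prop :=
  (forall i, 0 <= x i 0) /\
  x = \col_i Num.max 0 ((targets Gam - network_matrix Gam *m x) i 0).

Definition set_coord (x : 'cV[R]_N) (i : 'I_N) (t : R) : 'cV[R]_N :=
  \col_j (if j == i then t else x j 0).

Definition deviate x (i : 'I_N) (t1 t2 : R) : 'cV[R]_(N + N) :=
  col_mx (set_coord (usubmx x) i t1) (set_coord (dsubmx x) i t2).

End Game.

Section BestReply.
Variables (R : realType) (b : R -> R) (c q : R).
Hypotheses (db : forall t, derivable b t 1) (cb : strictly_concave b)
           (bq : b^`()%classic q = c).

Lemma concave_tangent_le z : b (q + z) - b q <= c * z.
Proof.
have [->|z0] := eqVneq z 0; first by rewrite addr0 subrr mulr0.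
have step t : 0 < t < 1 -> t * (b (q + z) - b q) <= b (q + t * z) - b q.
  move=> t01.
  have neq : q + z != q by rewrite -subr_eq0 addrC addKr.
  have := cb neq t01.
  have -> : t * (q + z) + (1 - t) * q = q + t * z by ring.
  by move=> /ltW; lra.
have dbq : derivable b q 1 by exact: db.
have /derivable1_diffP diffb := dbq.
have dz : derivable b q z by exact: diff_derivable.
have -> : c * z = 'D_z b q.
  by rewrite deriveE // deriv1E // bq mulrC.
have cv := @cvg_dnbhs_at_right R _ _ 0 _ dz.
have <- : lim (h^-1 *: ((b \o shift q) (h *: z) - b q) @[h --> 0^'+]) = 'D_z b q.
  exact: cvg_lim cv.
apply: limr_ge; first by apply/cvg_ex; eexists; exact: cv.
near=> h.
have h0 : 0 < h by [].
have h1 : h < 1 by near: h; exact: nbhs_right_lt.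
rewrite /= -[X in X <= _](mulKf (lt0r_neq0 h0)) [_ *: (_ - _)]/(_ * _).
rewrite ler_pM2l ?invr_gt0 // [h *: z]/(h * z) [h * z + q]addrC.
by apply: step; rewrite h0.
Unshelve. all: by end_near. Qed.

Lemma concave_tangent_lt y : y != q -> b y - b q < c * (y - q).
Proof.
move=> yq.
have h : 0 < (2^-1 : R) < 1 by lra.
have := cb yq h.
have := concave_tangent_le (2^-1 * (y - q)).
have -> : 2^-1 * y + (1 - 2^-1) * q = q + 2^-1 * (y - q) by field.
by move: (b (_ + _)) => w; lra.
Qed.

Lemma best_replyP (s u : R) : 0 <= u ->
  (forall t, 0 <= t -> b (t + s) - c * t <= b (u + s) - c * u) <->
  u = Num.max 0 (q - s).
Proof.
move=> u0; set m := Num.max 0 (q - s).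
have m0 : 0 <= m by rewrite le_max lexx.
have max_lt t : 0 <= t -> t != m -> b (t + s) - c * t < b (m + s) - c * m.
  rewrite /m; case: (leP 0 (q - s)) => qs t0 tm.
    have tq : t + s != q by apply: contra tm => /eqP <-; rewrite addrK.
    by have := concave_tangent_lt tq; rewrite subrK; lra.
  have tpos : 0 < t by rewrite lt_def tm.
  have tq : t + s != q by apply/eqP; lra.
  have := concave_tangent_lt tq.
  pose w := - (q - s) / (t - (q - s)).
  have d0 : 0 < t - (q - s) by lra.
  have w01 : 0 < w < 1.
    by rewrite /w divr_gt0 ?ltr_pdivrMr //; lra.
  have := cb tq w01.
  have -> : w * (t + s) + (1 - w) * q = s by rewrite /w; field; lra.
  rewrite add0r => H1 H2.
  have E : (1 - w) * (c * (t + s - q)) = c * t by rewrite /w; field; lra.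
  have : (1 - w) * (b (t + s) - b q) < c * t.
    by rewrite -E ltr_pM2l //; lra.
  by rewrite mulr0; move: H1; lra.
split=> [umax|-> t t0].
  apply/eqP; apply: contraT => um.
  by have := max_lt _ u0 um; rewrite ltNge umax.
by have [->//|tm] := eqVneq t m; apply/ltW/max_lt.
Qed.

End BestReply.

Lemma targetP (R : realType) (b : R -> R) (c : R) :
  admissible_benefit b c -> b^`()%classic (target b c) = c.
Proof.
by case=> _ _ _ _ [_ ex]; exact: (@xgetPex _ 0 [set q | b^`()%classic q = c]).
Qed.

Lemma sum_set_coord (R : realType) (N : nat) (A : 'M[R]_N) (x : 'cV[R]_N) i t :
  A i i = 0 ->
  \sum_j A i j * set_coord x i t j 0 = \sum_j A i j * x j 0.
Proof.
move=> Aii; apply: eq_bigr => j _; rewrite mxE.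
by case: eqP => // ->; rewrite Aii !mul0r.
Qed.

Lemma nash_equilibriumP (R : realType) (N : nat) (Gam : multilayer_game R N)
    (x : 'cV[R]_(N + N)) :
  0 < weight Gam < 1 -> admissible Gam ->
  (forall i, [/\ intra1 Gam i i = 0, intra2 Gam i i = 0,
                 inter12 Gam i i = 0 & inter21 Gam i i = 0]) ->
  nash_equilibrium Gam x <->
  (forall i, 0 <= x i 0) /\
  (forall i t1 t2, 0 <= t1 -> 0 <= t2 ->
     utility Gam (deviate x i t1 t2) i <= utility Gam x i).
Proof.
move=> /andP[w0 w1] adm diag0.
pose s1 i := \sum_j intra1 Gam i j * usubmx x j 0 +
             \sum_j inter12 Gam i j * dsubmx x j 0.
pose s2 i := \sum_j intra2 Gam i j * dsubmx x j 0 +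
             \sum_j inter21 Gam i j * usubmx x j 0.
pose f1 i t := benefit1 Gam i (t + s1 i) - cost1 Gam i * t.
pose f2 i t := benefit2 Gam i (t + s2 i) - cost2 Gam i * t.
have ux i : utility Gam x i = weight Gam * f1 i (usubmx x i 0) +
    (1 - weight Gam) * f2 i (dsubmx x i 0).
  by rewrite /utility /layer_utility /f1 /f2 /s1 /s2 !addrA.
have ud i t1 t2 : utility Gam (deviate x i t1 t2) i =
    weight Gam * f1 i t1 + (1 - weight Gam) * f2 i t2.
  have [d1 d2 d12 d21] := diag0 i.
  rewrite /utility /layer_utility /deviate col_mxKu col_mxKd.
  by rewrite !sum_set_coord // !mxE !eqxx /f1 /f2 /s1 /s2 !addrA.
have br1 i : usubmx x i 0 = x (lshift N i) 0 by rewrite mxE.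
have br2 i : dsubmx x i 0 = x (rshift N i) 0 by rewrite mxE.
have net : network_matrix Gam *m x =
    col_mx (\col_i s1 i) (\col_i s2 i).
  rewrite -[x in LHS]vsubmxK mul_block_col; congr col_mx.
    by apply/colP => i; rewrite !mxE.
  by apply/colP => i; rewrite !mxE addrC.
have P1 i u := @best_replyP R _ _ _ (let: And5 d _ _ _ _ := (adm i).1 in d)
  (let: And5 _ _ _ d _ := (adm i).1 in d) (targetP (adm i).1) (s1 i) u.
have P2 i u := @best_replyP R _ _ _ (let: And5 d _ _ _ _ := (adm i).2 in d)
  (let: And5 _ _ _ d _ := (adm i).2 in d) (targetP (adm i).2) (s2 i) u.
split=> -[x0 H]; split=> //.
  move=> i t1 t2 t10 t20; rewrite ux ud.
  have E1 : usubmx x i 0 = Num.max 0 (target (benefit1 Gam i) (cost1 Gam i) - s1 i).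
    by rewrite br1 {1}H net !mxE !(unsplitK (inl _)) !mxE.
  have E2 : dsubmx x i 0 = Num.max 0 (target (benefit2 Gam i) (cost2 Gam i) - s2 i).
    by rewrite br2 {1}H net !mxE !(unsplitK (inr _)) !mxE.
  apply: lerD; apply: ler_wpM2l; rewrite ?subr_ge0; try exact: ltW.
    by apply: (P1 i _ _).2 => //; rewrite br1.
  by apply: (P2 i _ _).2 => //; rewrite br2.
apply/colP => k; rewrite [RHS]mxE net; case: (splitP k) => i ki.
  have -> : k = lshift N i by exact: val_inj.
  rewrite !mxE !(unsplitK (inl _)) !mxE -br1; apply/(P1 i); first by rewrite br1.
  move=> t t0; have := H i t (dsubmx x i 0) t0.
  by rewrite ux ud lerD2r ler_pM2l //; apply; rewrite br2.
have -> : k = rshift N i by exact: val_inj.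
rewrite !mxE !(unsplitK (inr _)) !mxE -br2; apply/(P2 i); first by rewrite br2.
move=> t t0; have := H i (usubmx x i 0) t; rewrite br1 => /(_ (x0 _) t0).
by rewrite ux ud -br1 lerD2l ler_pM2l // subr_gt0.
Qed.

(* Main.v *)
Require Import Defs.
From HB Require Import structures.
From mathcomp Require Import all_boot all_order all_algebra.
From mathcomp Require Import all_classical all_reals all_analysis.
From mathcomp Require Import perm lra.

Set Implicit Arguments.
Unset Strict Implicit.
Unset Printing Implicit Defensive.

Import Order.TTheory GRing.Theory Num.Theory.
Import numFieldNormedType.Exports.

Local Open Scope ring_scope.

(* Both [I + G^(l)] are M-matrices, so they have monotone inverses.  For fixed
   efforts in the other layer, the best-reply map of a layer is then monotone and
   bounded by a supersolution, hence has a fixed point, and two such layer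
   equilibria for right-hand sides [r] and [s] satisfy
   [|x - y| <= (I + G^(l))^-1 |r - s|] componentwise.  Hence the layer equilibrium
   depends on the efforts in the other layer with Lipschitz constant
   [||(I + G^(l))^-1|| ||G^(lk)|| < 1], and the layer-1 parts of the Nash equilibria
   are the fixed points of a composition of two Euclidean contractions. *)

(** * Principal minors and monotonicity of P-matrices *)

Lemma mx_subE (V : zmodType) m n (A B : 'M[V]_(m, n)) i j :
  (A - B) i j = A i j - B i j.
Proof. by rewrite !mxE. Qed.

(** An injection between ordinals of equal size is a permutation; permuting rows and columns alike
    contributes its sign twice. *)
Lemma det_mxsub_inj (R : comPzRingType) k m (g : 'I_k -> 'I_m) (B : 'M[R]_m) :
  k = m -> injective g -> \det (mxsub g g B) = \det B.
Proof.
move=> km; case: _ / km B g => B g g_inj.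
have -> : mxsub g g B = row_perm (perm g_inj) (col_perm (perm g_inj) B).
  by apply/matrixP => i j; rewrite !mxE !permE.
rewrite row_permE col_permE !det_mulmx !det_perm mulrCA odd_permV.
by rewrite -signr_addb addbb mulr1.
Qed.

(** [f] factors through the enumeration of its image that [P_matrix] uses, so principal minors may
    be indexed in any order. *)
Lemma P_matrix_inj (R : realType) n (A : 'M[R]_n) k (f : 'I_k -> 'I_n) :
  P_matrix A -> injective f -> 0 < \det (mxsub f f A).
Proof.
move=> PA f_inj; pose S := f @: 'I_k.
have fS i : f i \in S by apply/imsetP; exists i.
pose g i := enum_rank_in (fS i) (f i).
have gK i : enum_val (g i) = f i by rewrite enum_rankK_in.
have g_inj : injective g.
  by move=> i j gij; apply: f_inj; rewrite -!gK gij.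
have -> : mxsub f f A =
    mxsub g g (mxsub (@enum_val _ (mem S)) (@enum_val _ (mem S)) A).
  by apply/matrixP => i j; rewrite !mxE !gK.
by rewrite det_mxsub_inj ?card_imset ?card_ord //; exact: PA.
Qed.

Lemma P_matrix_mxsub (R : realType) n (A : 'M[R]_n) k (f : 'I_k -> 'I_n) :
  P_matrix A -> injective f -> P_matrix (mxsub f f A).
Proof.
move=> PA f_inj S; rewrite -mxsub_comp; apply: P_matrix_inj => //.
by apply: inj_comp => //; exact: enum_val_inj.
Qed.

Lemma P_matrix_det (R : realType) n (A : 'M[R]_n) : P_matrix A -> 0 < \det A.
Proof.
by move=> PA; have := @P_matrix_inj R n A n id PA (@inj_id _); rewrite mxsub_id.
Qed.

(** Linearity in row [i]: that row is row [i] of [A] plus [c] times a unit row, along which [det B]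
    is expanded. *)
Lemma det_add_delta (R : comPzRingType) n (A : 'M[R]_n.+1) i c :
  \det (A + c *: delta_mx i i) =
  \det A + c * \det (mxsub (lift i) (lift i) A).
Proof.
pose B := \matrix_(k, l) if k == i then (l == i)%:R else A k l.
rewrite (@determinant_multilinear _ _ _ A B i 1 c) ?mul1r ?scale1r.
- congr (_ + _ * _); rewrite (expand_det_row _ i) (bigD1 i) //= big1 => [|l li].
    rewrite !mxE !eqxx mul1r addr0 /cofactor -signr_odd oddD addbb mul1r.
    congr (\det _); apply/matrixP => k l; rewrite !mxE.
    by rewrite eq_sym (negbTE (neq_lift _ _)).
  by rewrite !mxE eqxx (negbTE li) mul0r.
- by apply/rowP => l; rewrite !mxE !eqxx.
- apply/matrixP => k l; rewrite !mxE.
  by rewrite [lift _ _ == _]eq_sym (negbTE (neq_lift _ _)) mulr0 addr0.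
- apply/matrixP => k l; rewrite !mxE.
  by rewrite [lift _ _ == _]eq_sym (negbTE (neq_lift _ _)) mulr0 addr0.
Qed.

(** A principal minor through [i] grows by [c] times a smaller principal minor; the others do not
    change. *)
Lemma P_matrix_add_delta (R : realType) n (A : 'M[R]_n) i c :
  P_matrix A -> 0 <= c -> P_matrix (A + c *: delta_mx i i).
Proof.
move=> PA c0 S; set f := @enum_val _ _.
have f_inj : injective f by exact: enum_val_inj.
have [iS|iS] := boolP (i \in S); last first.
  suff -> : mxsub f f (A + c *: delta_mx i i) = mxsub f f A by exact: PA.
  apply/matrixP => k l; rewrite !mxE.
  suff /negbTE -> : f k != i by rewrite mulr0 addr0.
  by apply: contraNneq iS => <-; exact: enum_valP.
pose i' := enum_rank_in iS i.
have fi' : f i' = i by rewrite /f enum_rankK_in.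
have -> : mxsub f f (A + c *: delta_mx i i) =
    mxsub f f A + c *: delta_mx i' i'.
  by apply/matrixP => k l; rewrite !mxE -fi' !(inj_eq f_inj).
move: i' {fi'} (P_matrix_mxsub PA f_inj).
move: (mxsub f f A); case: #|_| => [|k] B i' PB; first by case: i'.
rewrite det_add_delta ltr_wpDr ?P_matrix_det //.
by rewrite mulr_ge0 // ltW // P_matrix_inj //; exact: lift_inj.
Qed.

Lemma P_matrix_add_diag (R : realType) n (A : 'M[R]_n) (d : 'rV[R]_n) :
  P_matrix A -> (forall i, 0 <= d 0 i) -> P_matrix (A + diag_mx d).
Proof.
move=> PA d0; rewrite diag_mx_sum_delta.
elim/big_rec: _ => [|i B _ IH]; first by rewrite addr0.
by rewrite addrCA addrC; exact: P_matrix_add_delta.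
Qed.

(* If [A w <= 0 < w] then [(A + D) w = 0] for some nonnegative diagonal [D]. *)
Lemma P_matrix_sign_reversal (R : realType) n (A : 'M[R]_n) (w : 'cV[R]_n) :
  P_matrix A -> (forall i, 0 < w i 0) -> (forall i, (A *m w) i 0 <= 0) -> n = 0%N.
Proof.
move=> PA w0 Aw; pose d := \row_i (- (A *m w) i 0 / w i 0).
have d0 i : 0 <= d 0 i by rewrite mxE divr_ge0 ?oppr_ge0 // ltW.
have /P_matrix_det/gt_eqF/negbT := P_matrix_add_diag PA d0.
rewrite -unitfE -unitmxE => uM.
have Mw : (A + diag_mx d) *m w = 0.
  apply/colP => i; rewrite mulmxDl mul_diag_mx !mxE divfK ?gt_eqF //.
  by rewrite subrr.
have := mulKmx uM w; rewrite Mw mulmx0 => w_eq0.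
have [//|n0] := posnP n.
by have := w0 (Ordinal n0); rewrite -w_eq0 mxE ltxx.
Qed.

(** Let [S] be the set of negative coordinates of [u]. The columns outside [S] contribute
    nonpositive terms to the rows in [S], so the principal submatrix on [S] maps [w = -u > 0] to a
    nonpositive vector; sign reversal then makes [S] empty. *)
Lemma monotone_mx (R : realType) n (A : 'M[R]_n) (u : 'cV[R]_n) :
  P_matrix A -> (forall i j, j != i -> A i j <= 0) ->
  (forall i, 0 <= (A *m u) i 0) -> forall i, 0 <= u i 0.
Proof.
move=> PA ZA Au i; rewrite leNgt; apply/negP => ui.
pose S := [set j | u j 0 < 0]; pose f := @enum_val _ (mem S).
have fS k : u (f k) 0 < 0 by have := enum_valP k; rewrite inE.
have f_inj : injective f by exact: enum_val_inj.
pose w : 'cV[R]_#|S| := \col_k - u (f k) 0.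
have /eqP : #|S| = 0%N.
  apply: (P_matrix_sign_reversal (P_matrix_mxsub PA f_inj) (w := w)) => k.
    by rewrite mxE oppr_gt0.
  have := Au (f k); rewrite !mxE (bigID (mem S)) /= => Auk.
  under eq_bigr do rewrite !mxE mulrN.
  rewrite sumrN oppr_le0 -(big_enum_val (fun j => A (f k) j * u j 0)).
  apply: le_trans Auk _; rewrite gerDl; apply: sumr_le0 => j.
  rewrite inE -leNgt => uj; apply: mulr_le0_ge0 => //; apply: ZA.
  by apply: contraTneq uj => ->; rewrite -ltNge fS.
by rewrite cards_eq0 => /eqP/setP/(_ i); rewrite !inE ui.
Qed.

(** * Equilibria of a single layer *)

Definition layer_equilibrium (R : realType) n (G : 'M[R]_n) (r x : 'cV[R]_n) :=
  x = \col_i Num.max 0 ((r - G *m x) i 0).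

Section Layer.
Variables (R : realType) (n : nat) (G : 'M[R]_n).
Hypotheses (G0 : forall i, G i i = 0) (Gle0 : forall i j, j != i -> G i j <= 0).
Hypothesis PG : P_matrix (1%:M + G).

Let Gneg i j : G i j <= 0.
Proof. by have [->|/Gle0//] := eqVneq j i; rewrite G0. Qed.

Let addG i (u : 'cV[R]_n) :
  ((1%:M + G) *m u) i 0 = u i 0 + \sum_j G i j * u j 0.
Proof. by rewrite mulmxDl mul1mx !mxE. Qed.

Let unitG : 1%:M + G \in unitmx.
Proof. by rewrite unitmxE unitfE gt_eqF ?P_matrix_det. Qed.

Let monoG (u : 'cV[R]_n) :
  (forall i, 0 <= ((1%:M + G) *m u) i 0) -> forall i, 0 <= u i 0.
Proof.
apply: monotone_mx => // i j ji.
by rewrite !mxE eq_sym (negbTE ji) add0r Gle0.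
Qed.

(** The positive part is nonexpansive and [G <= 0], so [d = |x - y|] satisfies
    [(I + G) d <= |r - s|]; the monotone inverse gives the bound. *)
Lemma layer_equilibrium_lipschitz r s x y :
  layer_equilibrium G r x -> layer_equilibrium G s y ->
  forall i, `|x i 0 - y i 0| <=
            (invmx (1%:M + G) *m (\col_j `|r j 0 - s j 0|)) i 0.
Proof.
move=> xr ys; set b := \col_j _; pose d := \col_j `|x j 0 - y j 0|.
suff H i : 0 <= (invmx (1%:M + G) *m b - d) i 0.
  by move=> i; have := H i; rewrite mx_subE subr_ge0 [d i 0]mxE.
move: i; apply: monoG => i.
rewrite mulmxBr mulKVmx // mx_subE subr_ge0 addG.
have -> : d i 0 = `|x i 0 - y i 0| by rewrite mxE.
have -> : b i 0 = `|r i 0 - s i 0| by rewrite mxE.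
have xi : x i 0 = Num.max 0 (r i 0 - \sum_j G i j * x j 0).
  by rewrite {1}xr !mxE.
have yi : y i 0 = Num.max 0 (s i 0 - \sum_j G i j * y j 0).
  by rewrite {1}ys !mxE.
have : `|\sum_j G i j * x j 0 - \sum_j G i j * y j 0| <=
    - \sum_j G i j * d j 0.
  rewrite -sumrB -sumrN; apply: le_trans (ler_norm_sum _ _ _) _.
  by apply: ler_sum => j _; rewrite -mulrBr normrM ler0_norm // mulNr mxE.
rewrite xi yi; move: (\sum_j _ * x _ _) (\sum_j _ * y _ _) (\sum_j _ * d _ _).
move=> X Y D; rewrite ler_norml => /andP[? ?].
have := ler_norm (r i 0 - s i 0); have := ler_norm (s i 0 - r i 0).
rewrite distrC; set a := `|_ - _| => ? ?.
rewrite -lerBrDr ler_norml; apply/andP.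
by case: (leP 0 (r i 0 - X)); case: (leP 0 (s i 0 - Y)) => ? ?; split; lra.
Qed.

(* The least supersolution is a solution because the best reply is monotone. *)
Lemma layer_equilibrium_exists r : exists x, layer_equilibrium G r x.
Proof.
pose super (z : 'cV[R]_n) :=
  forall i, 0 <= z i 0 /\ r i 0 - \sum_j G i j * z j 0 <= z i 0.
have [z0 super0] : exists z, super z.
  (* This vector solves [(I + G) z = |r|], hence it is nonnegative and [z + G z >= r]. *)
  exists (invmx (1%:M + G) *m \col_j `|r j 0|) => i.
  set z := _ *m _.
  have Az k : ((1%:M + G) *m z) k 0 = `|r k 0| by rewrite mulKVmx // mxE.
  split; first by apply: monoG => k; rewrite Az.
  by have := Az i; rewrite addG; have := ler_norm (r i 0); lra.
pose E i := [set z i 0 | z in [set z | super z]]%classic.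
(* The candidate is the componentwise infimum of all supersolutions. *)
pose x : 'cV[R]_n := \col_i inf (E i).
have lbE i : lbound (E i) 0 by move=> _ [z /(_ i)[z_ge0 _] <-].
have x_le z i : super z -> x i 0 <= z i 0.
  move=> sz; rewrite mxE; apply: ge_inf; first by exists 0; exact: lbE.
  by exists z.
have x_ge c i : (forall z, super z -> c <= z i 0) -> c <= x i 0.
  move=> cz; rewrite mxE; apply: lb_le_inf; first by exists (z0 i 0); exists z0.
  by move=> _ [z /cz ? <-].
pose F (z : 'cV[R]_n) := \col_i Num.max 0 (r i 0 - \sum_j G i j * z j 0).
have F_mono (y z : 'cV[R]_n) i :
    (forall j, y j 0 <= z j 0) -> F y i 0 <= F z i 0.
  move=> yz; rewrite !mxE ge_max !le_max lexx /=; apply/orP; right.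
  rewrite lerB // ler_sum // => j _.
  by rewrite ler_wnM2l.
have super_F z : super z <-> forall i, F z i 0 <= z i 0.
  by split=> H i; have := H i; rewrite mxE ge_max => /andP.
have Fx i : F x i 0 <= x i 0.
  apply: x_ge => z sz; apply: le_trans ((super_F z).1 sz i).
  by apply: F_mono => j; exact: x_le.
exists x; apply/colP => i; apply/eqP; rewrite eq_le.
have -> : \col_i0 Num.max 0 ((r - G *m x) i0 0) = F x.
  by apply/colP => k; rewrite !mxE.
(* Since [F] is monotone and [F x <= x], [F x] is again a supersolution, whence [x <= F x]. *)
by rewrite Fx andbT; apply/x_le/super_F => j; exact: F_mono.
Qed.

End Layer.

(** * Euclidean norm and spectral norm *)

Section Norms.
Variable R : realType.

Lemma euclidean_norm_ge0 n (x : 'cV[R]_n) : 0 <= euclidean_norm x.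
Proof. exact: sqrtr_ge0. Qed.

Lemma le_euclidean_norm n (x y : 'cV[R]_n) :
  (forall i, `|x i 0| <= `|y i 0|) -> euclidean_norm x <= euclidean_norm y.
Proof.
move=> xy; apply: ler_wsqrtr; apply: ler_sum => i _.
by rewrite -real_normK ?num_real // -[leRHS]real_normK ?num_real // lerXn2r ?nnegrE.
Qed.

Lemma euclidean_norm_const n (c : R) :
  0 <= c -> euclidean_norm (const_mx c : 'cV[R]_n) = c * Num.sqrt n%:R.
Proof.
move=> c0; rewrite /euclidean_norm.
under eq_bigr do rewrite mxE.
rewrite sumr_const card_ord -[in LHS]mulr_natr sqrtrM ?sqr_ge0 //.
by rewrite sqrtr_sqr ger0_norm.
Qed.

Lemma coord_le_euclidean_norm n (x : 'cV[R]_n) i : `|x i 0| <= euclidean_norm x.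
Proof.
rewrite -sqrtr_sqr; apply: ler_wsqrtr.
by rewrite (bigD1 i) //= lerDl sumr_ge0 // => j _; rewrite sqr_ge0.
Qed.

Lemma euclidean_norm_eq0 n (x : 'cV[R]_n) : euclidean_norm x <= 0 -> x = 0.
Proof.
move=> x0; apply/colP => i; rewrite mxE; apply/eqP; rewrite -normr_le0.
exact: le_trans (coord_le_euclidean_norm x i) x0.
Qed.

(** Makes the supremum in [spectral_norm] a genuine one. Each coordinate of [A x] is at most [a]
    times the norm of [x]; comparison with a constant vector gives the factor [sqrt m]. *)
Lemma euclidean_norm_mulmx_bounded m n (A : 'M[R]_(m, n)) :
  exists c, forall x, euclidean_norm (A *m x) <= c * euclidean_norm x.
Proof.
pose a := \sum_i \sum_j `|A i j|.
have a0 : 0 <= a by apply: sumr_ge0 => i _; exact: sumr_ge0.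
exists (a * Num.sqrt m%:R) => x; have x0 := euclidean_norm_ge0 x.
rewrite mulrAC -euclidean_norm_const ?mulr_ge0 //.
apply: le_euclidean_norm => i; rewrite !mxE [leRHS]ger0_norm ?mulr_ge0 //.
apply: le_trans (ler_norm_sum _ _ _) _.
apply: (@le_trans _ _ (\sum_j `|A i j| * euclidean_norm x)).
  by apply: ler_sum => j _; rewrite normrM ler_wpM2l // coord_le_euclidean_norm.
rewrite -mulr_suml ler_wpM2r // /a (bigD1 i) //= lerDl.
by apply: sumr_ge0 => k _; exact: sumr_ge0.
Qed.

Lemma spectral_normP m n (A : 'M[R]_(m, n)) x :
  euclidean_norm (A *m x) <= spectral_norm A * euclidean_norm x.
Proof.
have [->|x0] := eqVneq x 0.
  have norm0 k : euclidean_norm (0 : 'cV[R]_k) = 0.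
    by have := @euclidean_norm_const k 0 (lexx _); rewrite mul0r.
  by rewrite mulmx0 !norm0 mulr0.
have nx k (y : 'cV[R]_k) : y != 0 -> 0 < euclidean_norm y.
  by rewrite ltNge; apply: contraNN => /euclidean_norm_eq0/eqP.
rewrite -ler_pdivrMr ?nx //; apply: ub_le_sup; last by exists x.
have [c cP] := euclidean_norm_mulmx_bounded A.
by exists c => _ [y /= y0 <-]; rewrite ler_pdivrMr ?nx.
Qed.

Lemma spectral_norm_ge0 m n (A : 'M[R]_(m, n)) : 0 <= spectral_norm A.
Proof.
case: n A => [|n] A.
  (* Without columns the set of quotients is empty and its [sup] is 0. *)
  rewrite /spectral_norm (_ : [set _ | _ in _]%classic = set0) ?sup0 //.
  by rewrite -subset0 => _ [x /= /eqP[]]; apply/colP; case.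
have x0 : 0 < euclidean_norm (const_mx 1 : 'cV[R]_n.+1).
  by rewrite euclidean_norm_const // mul1r sqrtr_gt0.
rewrite -(pmulr_lge0 _ x0); apply: le_trans (spectral_normP A _).
exact: euclidean_norm_ge0.
Qed.

End Norms.

(** * Fixed points of Euclidean contractions *)

HB.instance Definition _ (R : realType) m n := Complete.on 'M[R]_(m, n).

(* The norm of ['cV[R]_n] in the library is the sup norm; some iterate of [T] is a
   contraction for it, and the fixed point of that iterate is fixed by [T]. *)
Lemma euclidean_contraction_fixpoint (R : realType) n (T : 'cV[R]_n -> 'cV[R]_n) c :
  0 <= c < 1 ->
  (forall x y, euclidean_norm (T x - T y) <= c * euclidean_norm (x - y)) ->
  exists x, T x = x.
Proof.
move=> /andP[c0 c1] Tc.
have iterc k x y : euclidean_norm (iter k T x - iter k T y) <=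
    c ^+ k * euclidean_norm (x - y).
  elim: k => [|k IH]; first by rewrite mul1r.
  by rewrite exprS -mulrA; apply: le_trans (Tc _ _) _; rewrite ler_wpM2l.
(* A positive exponent makes the factor smaller than 1, so such an iterate has at most one fixed
   point. *)
have fix_unique k x y : iter k.+1 T x = x -> iter k.+1 T y = y -> x = y.
  move=> xk yk; apply/eqP; rewrite -subr_eq0; apply/eqP/euclidean_norm_eq0.
  have := iterc k.+1 x y; rewrite xk yk.
  have : c ^+ k.+1 < 1 by rewrite exprn_ilt1.
  have := euclidean_norm_ge0 (x - y).
  by move: (c ^+ _) (euclidean_norm _) => ? ?; nra.
(* Passing from the sup norm to the Euclidean norm costs [sqrt n]. The summand 1 in the threshold
   below keeps it positive when [n = 0]. *)
have [k ck] : exists k, c ^+ k.+1 * Num.sqrt n%:R < 1.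
  have /cvgrPdist_lt /(_ (1 + Num.sqrt n%:R)^-1) :
      (c ^+ x @[x --> \oo] --> (0 : R))%classic.
    by apply: cvg_expr; rewrite ger0_norm.
  have s0 : 0 < 1 + Num.sqrt n%:R :> R by rewrite ltr_pwDl.
  rewrite invr_gt0 => /(_ s0)[k _ /(_ k.+1 (leqnSn k))] /=.
  rewrite sub0r normrN ger0_norm ?exprn_ge0 // => H; exists k.
  have : c ^+ k.+1 * (1 + Num.sqrt n%:R) < 1 by rewrite -ltr_pdivlMr // div1r.
  by have := exprn_ge0 k.+1 c0; lra.
have q0 : 0 <= c ^+ k.+1 * Num.sqrt n%:R by rewrite mulr_ge0 ?exprn_ge0 ?sqrtr_ge0.
pose f : {fun [set: 'cV[R]_n] >-> [set: 'cV[R]_n]} :=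
  [fun of totalfun (iter k.+1 T)].
have [||x _ fx] := @banach_fixed_point R 'cV[R]_n setT f _ closedT.
- exists (NngNum q0); split=> //= -[x y] _ /=.
  rewrite [leLHS]/Num.norm /= mx_normrE; apply: bigmax_le => [|[i j] _] /=.
    by rewrite mulr_ge0.
  rewrite ord1; apply: le_trans (coord_le_euclidean_norm _ i) _.
  apply: le_trans (iterc _ _ _) _; rewrite -mulrA ler_wpM2l ?exprn_ge0 //.
  rewrite mulrC -euclidean_norm_const //; apply: le_euclidean_norm => l.
  rewrite [X in _ <= `|X|]mxE normr_id [leRHS]/Num.norm /= mx_normrE.
  exact: (le_bigmax _ (fun ij => `|(x - y) ij.1 ij.2|) (l, 0)).
- by exists 0.
(* [T x] is fixed by the same iterate as [x], so uniqueness identifies them. *)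
exists x; apply: (fix_unique k) => //; rewrite -iterSr iterS.
by congr T.
Qed.

(** * The coupled two-layer system *)

Lemma layer_equilibrium_norm (R : realType) n (G H : 'M[R]_n)
    (q u v x y : 'cV[R]_n) :
  (forall i, G i i = 0) -> (forall i j, j != i -> G i j <= 0) ->
  P_matrix (1%:M + G) ->
  layer_equilibrium G (q - H *m u) x -> layer_equilibrium G (q - H *m v) y ->
  euclidean_norm (x - y) <=
  spectral_norm (invmx (1%:M + G)) * spectral_norm H * euclidean_norm (u - v).
Proof.
move=> G0 Gle0 PG xu yv.
have xy := layer_equilibrium_lipschitz G0 Gle0 PG xu yv.
move: xy; set b := \col_j _ => xy.
apply: (@le_trans _ _ (euclidean_norm (invmx (1%:M + G) *m b))).
  apply: le_euclidean_norm => i; rewrite mx_subE.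
  exact: le_trans (xy i) (ler_norm _).
apply: le_trans (spectral_normP _ _) _.
rewrite -mulrA ler_wpM2l ?spectral_norm_ge0 //.
apply: le_trans (spectral_normP _ _).
apply: le_euclidean_norm => i; rewrite mxE normr_id.
(* The targets [q] cancel; only the change in the other layer's efforts remains. *)
have -> : (q - H *m u) i 0 - (q - H *m v) i 0 = - (H *m (u - v)) i 0.
  by rewrite mulmxBr !mx_subE; lra.
by rewrite normrN.
Qed.

(** The block product separates the layers; nonnegativity is automatic for a maximum with 0. *)
Lemma nash_equilibrium_layers (R : realType) N (Gam : multilayer_game R N) x1 x2 :
  nash_equilibrium Gam (col_mx x1 x2) <->
  layer_equilibrium (intra1 Gam) (usubmx (targets Gam) - inter12 Gam *m x2) x1 /\
  layer_equilibrium (intra2 Gam) (dsubmx (targets Gam) - inter21 Gam *m x1) x2.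
Proof.
pose F (r : 'cV[R]_N) : 'cV[R]_N := \col_i Num.max 0 (r i 0).
pose r1 := usubmx (targets Gam) - inter12 Gam *m x2 - intra1 Gam *m x1.
pose r2 := dsubmx (targets Gam) - inter21 Gam *m x1 - intra2 Gam *m x2.
have E : \col_i Num.max 0 ((targets Gam - network_matrix Gam *m col_mx x1 x2) i 0)
    = col_mx (F r1) (F r2).
  rewrite -[targets Gam]vsubmxK /network_matrix mul_block_col opp_col_mx add_col_mx.
  rewrite [intra1 Gam *m _ + _]addrC !opprD !addrA.
  apply/colP => i; rewrite mxE -[i]fintype.splitK; case: (fintype.split i) => j /=.
    by rewrite !col_mxEu [RHS]mxE.
  by rewrite !col_mxEd [RHS]mxE.
rewrite /nash_equilibrium E; split=> [[_ xE]|[x1E x2E]].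
  by have [? ?] := eq_col_mx xE.
have xE : col_mx x1 x2 = col_mx (F r1) (F r2).
  by congr col_mx; [exact: x1E|exact: x2E].
split=> // i; rewrite xE -[i]fintype.splitK; case: (fintype.split i) => j /=.
  by rewrite col_mxEu mxE le_max lexx.
by rewrite col_mxEd mxE le_max lexx.
Qed.

Theorem proposition7 (R : realType) (N : nat) (G1 G2 G12 G21 : 'M[R]_N)
    (diag1 : forall i, G1 i i = 0) (diag2 : forall i, G2 i i = 0)
    (complements1 : forall i j, j != i -> G1 i j <= 0)
    (complements2 : forall i j, j != i -> G2 i j <= 0)
    (P1 : P_matrix (1%:M + G1)) (P2 : P_matrix (1%:M + G2))
    (small12 : spectral_norm (invmx (1%:M + G1)) * spectral_norm G12 < 1)
    (small21 : spectral_norm (invmx (1%:M + G2)) * spectral_norm G21 < 1)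
    (kappa : R) (b1 b2 : 'I_N -> R -> R) (c1 c2 : 'I_N -> R) :
  let Gam := MultilayerGame kappa G1 G2 G12 G21 b1 b2 c1 c2 in
  admissible Gam -> exists! x : 'cV[R]_(N + N), nash_equilibrium Gam x.
Proof.
move=> Gam _.
pose q1 := usubmx (targets Gam); pose q2 := dsubmx (targets Gam).
have lip1 := @layer_equilibrium_norm _ _ _ G12 q1 _ _ _ _ diag1 complements1 P1.
have lip2 := @layer_equilibrium_norm _ _ _ G21 q2 _ _ _ _ diag2 complements2 P2.
move: small12 small21 lip1 lip2; set a1 := _ * _; set a2 := _ * _.
move=> a1_lt1 a2_lt1 lip1 lip2.
have a1_ge0 : 0 <= a1 by rewrite mulr_ge0 ?spectral_norm_ge0.
have a2_ge0 : 0 <= a2 by rewrite mulr_ge0 ?spectral_norm_ge0.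
have a12 : 0 <= a1 * a2 < 1 by rewrite mulr_ge0 // mulr_ilt1.
have [f1 f1P] := choice (layer_equilibrium_exists diag1 complements1 P1).
have [f2 f2P] := choice (layer_equilibrium_exists diag2 complements2 P2).
(* Each map answers the efforts of the other layer by a chosen layer equilibrium. *)
pose phi1 x2 := f1 (q1 - G12 *m x2); pose phi2 x1 := f2 (q2 - G21 *m x1).
have [x y|x1 x1E] := @euclidean_contraction_fixpoint _ _ (phi1 \o phi2) _ a12.
  apply: le_trans (lip1 _ _ _ _ (f1P _) (f1P _)) _.
  by rewrite -(mulrA a1) ler_wpM2l //; exact: lip2 (f2P _) (f2P _).
exists (col_mx x1 (phi2 x1)); split.
  by apply/nash_equilibrium_layers; split; [rewrite -{2}x1E; exact: f1P|exact: f2P].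
move=> y; rewrite -[y]vsubmxK => /nash_equilibrium_layers[/= y1E y2E].
(* The Lipschitz bounds hold for any layer equilibria, so they also compare the chosen ones with the
   blocks of an arbitrary Nash equilibrium [y]. *)
have d2 := lip2 _ _ _ _ (f2P _) y2E.
have x1P : layer_equilibrium G1 (q1 - G12 *m phi2 x1) x1.
  by rewrite -{2}x1E; exact: f1P.
have d1 := lip1 _ _ _ _ x1P y1E.
(* Chaining both bounds, the distance of the first blocks is at most [a1 * a2 < 1] times itself. *)
have xy1 : x1 = usubmx y.
  apply/eqP; rewrite -subr_eq0; apply/eqP/euclidean_norm_eq0.
  have /andP[_ a12_lt1] := a12.
  have := le_trans d1 (ler_wpM2l a1_ge0 (d2 x1)); rewrite mulrA.
  by have := euclidean_norm_ge0 (x1 - usubmx y); nra.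
congr col_mx => //; apply/eqP; rewrite -subr_eq0; apply/eqP/euclidean_norm_eq0.
apply: le_trans (d2 x1) _; rewrite xy1 subrr.
by rewrite /euclidean_norm big1 ?sqrtr0 ?mulr0 // => i _; rewrite mxE expr0n.
Qed.
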